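(* Let $d$ be a positive integer and let $f$ be a smooth height function in a neighborhood of the origin of a $uvw$ coordinate frame, with $c_{jk}=\frac{\partial^{j+k}f}{\partial u^j\partial v^k}(0,0)$. For each small mesh size $h>0$, let a set of points $[u_i,v_i,f_i]^T$, $i=1,\dots,m$, be given in the $uvw$ frame that interpolate $f$ (i.e. $f_i=f(u_i,v_i)$) or approximate $f$ with an error of $O(h^{d+1})$ along the $w$ direction (i.e. $f_i=f(u_i,v_i)+O(h^{d+1})$). Assume that the point distribution and the weighting matrix $\mathbf{W}$ are independent of the mesh resolution, and that the scaled matrix $\mathbf{A}\mathbf{S}$ of the weighted least squares problem has a condition number bounded independently of $h$. Then the degree-$d$ weighted least squares fitting approximates $c_{jk}$ to $O(h^{d-j-k+1})$ for all $j,k\ge0$ with $j+k\le d$.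
   Context: Degree-$d$ weighted least squares fitting: let $n=(d+1)(d+2)/2$ and $m\ge n$. Let $\mathbf{V}$ be the $m\times n$ generalized Vandermonde matrix whose $i$th row has entries $\frac{u_i^jv_i^k}{j!\,k!}$, indexed by $j,k\ge0$, $j+k\le d$, and let $\mathbf{f}=[f_1,\dots,f_m]^T$. Given the diagonal weighting matrix $\mathbf{W}=\operatorname{diag}(\omega_1,\dots,\omega_m)$ with nonnegative entries, put $\mathbf{A}=\mathbf{W}\mathbf{V}$, $\mathbf{b}=\mathbf{W}\mathbf{f}$. The column scaling matrix is $\mathbf{S}=\operatorname{diag}(1/\|\mathbf{a}_1\|_2,\dots,1/\|\mathbf{a}_n\|_2)$, where $\mathbf{a}_j$ is the $j$th column of $\mathbf{A}$. The fitting solves $\min_{\mathbf{d}}\|(\mathbf{A}\mathbf{S})\mathbf{d}-\mathbf{b}\|_2$ and takes $\mathbf{S}\mathbf{d}$, an $n$-vector with entries indexed by $(j,k)$, as the approximation of the vector of the $c_{jk}$. The condition number is the ratio of the largest to the smallest singular value ($\mathbf{AS}$ having full column rank). Mesh size and independence of resolution: $h$ is the average edge length of the mesh, and the asymptotics are for $h\to0$ with $f$ and $d$ fixed. ''The point distribution and the weighting matrix are independent of the mesh resolution'' means: $m$ is independent of $h$; every point $(u_i,v_i)$ other than the origin (the vertex at which one fits, which may be among the points) satisfies $u_i=\Theta(h)$ and $v_i=\Theta(h)$; and the weights satisfy $\omega_i=\Theta(1)$; all with constants independent of $h$. *)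

(* Defs.v *)
From HB Require Import structures.
From mathcomp Require Import all_boot all_order all_algebra.
From mathcomp Require Import all_classical all_reals all_analysis.

Set Implicit Arguments.
Unset Strict Implicit.
Unset Printing Implicit Defensive.

Import Order.TTheory GRing.Theory Num.Theory numFieldNormedType.Exports.

Local Open Scope classical_set_scope.
Local Open Scope ring_scope.

Definition partial_u {R : realType} (f : R -> R -> R) : R -> R -> R :=
  fun u v => derive1 (fun x : R => f x v) u.

Definition partial_v {R : realType} (f : R -> R -> R) : R -> R -> R :=
  fun u v => derive1 (fun y : R => f u y) v.

Definition partial {R : realType} (j k : nat) (f : R -> R -> R) : R -> R -> R :=
  iter j partial_u (iter k partial_v f).

Fixpoint C_on {R : realType} (U : set (R * R)) (r : nat) (f : R -> R -> R)
    : Prop :=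
  (forall z, U z -> {for z, continuous (fun p : R * R => f p.1 p.2)}) /\
  if r is r'.+1 then
    [/\ (forall z, U z -> derivable (fun x : R => f x z.2) z.1 1),
        (forall z, U z -> derivable (fun y : R => f z.1 y) z.2 1),
        C_on U r' (partial_u f) & C_on U r' (partial_v f)]
  else True.

(* f is total, but its values outside U are irrelevant. *)
Definition smooth_near_origin {R : realType} (f : R -> R -> R) : Prop :=
  exists U : set (R * R), [/\ open U, U (0, 0) & forall r, C_on U r f].

Definition l2norm {R : realType} {n : nat} (x : 'cV[R]_n) : R :=
  Num.sqrt (\sum_(i < n) x i 0 ^+ 2).

(* For m >= n only: then M has n singular values, the nonnegative square
   roots of the eigenvalues of M^T M (for m < n spurious zeros appear). *)
Definition singular_values {R : realType} {m n : nat} (M : 'M[R]_(m, n))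
    : set R :=
  [set s | 0 <= s /\ eigenvalue (M^T *m M) (s ^+ 2)].

(* The set of singular values is finite, so sup and inf are its maximum and
   minimum when n > 0. *)
Definition condition_number {R : realType} {m n : nat} (M : 'M[R]_(m, n)) : R :=
  sup (singular_values M) / inf (singular_values M).

Definition exponents (d : nat) : finType :=
  {p : 'I_d.+1 * 'I_d.+1 | (p.1 + p.2 <= d)%N}.

Definition uexp {d : nat} (p : exponents d) : nat := (val p).1.
Definition vexp {d : nat} (p : exponents d) : nat := (val p).2.

Definition ncoef (d : nat) : nat := #|exponents d|.

Lemma ncoefE (d : nat) : ncoef d = ((d.+1 * d.+2)./2)%N.
Proof.
rewrite /ncoef card_sig -sum1_card.
rewrite (eq_bigl (fun p : 'I_d.+1 * 'I_d.+1 => (p.1 + p.2 <= d)%N)) //.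
rewrite -(pair_big_dep xpredT (fun i j : 'I_d.+1 => (i + j <= d)%N)
           (fun _ _ => 1%N)) /=.
have E (i : 'I_d.+1) : (\sum_(j < d.+1 | i + j <= d) 1 = d.+1 - i)%N.
  rewrite (eq_bigl (fun j : 'I_d.+1 => (j < d.+1 - i)%N)); last first.
    by move=> j; rewrite ltn_subRL ltnS.
  by rewrite -(big_ord_widen d.+1 (fun=> 1%N)) ?leq_subr // sum1_card card_ord.
rewrite (eq_bigr _ (fun i _ => E i)) (reindex_inj rev_ord_inj) /=.
rewrite (eq_bigr (fun i : 'I_d.+1 => i.+1)); last first.
  by move=> i _; rewrite subnA ?subnn // ?ltn_ord // -ltnS.
have -> : (\sum_(i < d.+1) i.+1 = \sum_(i < d.+2) i)%N.
  by rewrite [RHS]big_ord_recl add0n.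
by rewrite -(big_mkord xpredT id) bin2_sum bin2 [(d.+2 * _)%N]mulnC.
Qed.

Definition vandermonde {R : realType} (d : nat) {m : nat} (u v : 'I_m -> R)
    : 'M[R]_(m, ncoef d) :=
  \matrix_(i < m, r < ncoef d)
    (let j := uexp (enum_val r) in let k := vexp (enum_val r) in
     u i ^+ j * v i ^+ k / (j`!%:R * k`!%:R)).

Definition weight_mx {R : realType} {m : nat} (w : 'I_m -> R) : 'M[R]_m :=
  diag_mx (\row_(i < m) w i).

Definition wls_mx {R : realType} (d : nat) {m : nat} (u v w : 'I_m -> R)
    : 'M[R]_(m, ncoef d) :=
  weight_mx w *m vandermonde d u v.

Definition wls_rhs {R : realType} {m : nat} (w F : 'I_m -> R) : 'cV[R]_m :=
  weight_mx w *m \col_(i < m) F i.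

(* A zero column is scaled by 0^-1 = 0, so A *m col_scaling A is then rank
   deficient. *)
Definition col_scaling {R : realType} {m n : nat} (A : 'M[R]_(m, n)) : 'M[R]_n :=
  diag_mx (\row_(j < n) (l2norm (col j A))^-1).

Definition is_least_squares {R : realType} {m n : nat}
    (M : 'M[R]_(m, n)) (b : 'cV[R]_m) (x : 'cV[R]_n) : Prop :=
  forall y : 'cV[R]_n, l2norm (M *m x - b) <= l2norm (M *m y - b).

(* c is a degree-d fitting of the data: c = S x with x a minimizer of the
   column-scaled problem. *)
Definition is_wls_fitting {R : realType} (d : nat) {m : nat}
    (u v w F : 'I_m -> R) (c : 'cV[R]_(ncoef d)) : Prop :=
  let A := wls_mx d u v w in
  let S := col_scaling A in
  exists2 x : 'cV[R]_(ncoef d),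
    is_least_squares (A *m S) (wls_rhs w F) x & c = S *m x.

Definition fitted_coef {R : realType} {d : nat} (c : 'cV[R]_(ncoef d))
    (p : exponents d) : R :=
  c (enum_rank p) 0.

(* The constants are uniform in h and i, and which points sit at the origin
   may depend on h. *)
Definition points_resolution_independent {R : realType} {m : nat}
    (u v : R -> 'I_m -> R) : Prop :=
  exists c1 c2 : R, [/\ 0 < c1, 0 < c2 &
    \forall h \near (0 : R)^'+, forall i : 'I_m,
      (u h i, v h i) <> (0, 0) ->
      c1 * h <= `|u h i| <= c2 * h /\ c1 * h <= `|v h i| <= c2 * h].

Definition weights_resolution_independent {R : realType} {m : nat}
    (w : R -> 'I_m -> R) : Prop :=
  exists c1 c2 : R, [/\ 0 < c1, 0 < c2 &
    \forall h \near (0 : R)^'+, forall i : 'I_m,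
      0 <= w h i /\ c1 <= `|w h i| <= c2].

(* Main.v *)
(** Let z be the vector of true coefficients c_jk and x the minimizer, so that
    the fit is S x, and write z = S y.  Comparing the minimum with the value at
    y gives |AS(x - y)| <= 2 |Az - b|, and Taylor's formula bounds the right-hand
    side by O(h^(d+1)).  The columns of AS are unit vectors, so its largest
    singular value is at least 1 and the smallest at least 1/K; hence
    x - y = O(h^(d+1)).  Unscaling divides the (j,k) entry by the norm of the
    (j,k) column of A, which is at least a constant times h^(j+k) because of a
    single sample point off the origin; such a point exists since d > 0 and A has
    full column rank. *)
Require Import Defs.
From mathcomp Require Import all_boot all_order all_algebra.
From mathcomp Require Import all_classical all_reals all_analysis.
From mathcomp Require Import ring lra.
Import Order.TTheory GRing.Theory Num.Theory numFieldNormedType.Exports.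
Local Open Scope classical_set_scope.
Local Open Scope ring_scope.

(** * Extreme eigenvalues and the condition number *)

Definition sqnorm {R : realType} {n : nat} (x : 'cV[R]_n) : R :=
  \sum_(i < n) x i 0 ^+ 2.

Definition quad_form {R : realType} {n : nat} (B : 'M[R]_n) (x : 'cV[R]_n) : R :=
  (x^T *m B *m x) 0 0.

Section QuadraticForms.
Context {R : realType}.
Implicit Types m n : nat.

Lemma sqnorm_ge0 n (x : 'cV[R]_n) : 0 <= sqnorm x.
Proof. by apply: sumr_ge0 => i _; apply: sqr_ge0. Qed.

Lemma sqnormE n (x : 'cV[R]_n) : sqnorm x = (x^T *m x) 0 0.
Proof. by rewrite mxE; apply: eq_bigr => i _; rewrite mxE expr2. Qed.

Lemma sqnorm_l2norm n (x : 'cV[R]_n) : l2norm x ^+ 2 = sqnorm x.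
Proof. by rewrite sqr_sqrtr ?sqnorm_ge0. Qed.

Lemma sqr_coord_le_sqnorm n (x : 'cV[R]_n) i : x i 0 ^+ 2 <= sqnorm x.
Proof.
rewrite /sqnorm (bigD1 i) //= lerDl; apply: sumr_ge0 => j _; exact: sqr_ge0.
Qed.

Lemma sqnorm_eq0 n (x : 'cV[R]_n) : (sqnorm x == 0) = (x == 0).
Proof.
apply/eqP/eqP => [x0|->]; last by rewrite /sqnorm big1 // => i _; rewrite mxE expr0n.
apply/colP => i; rewrite mxE; apply/eqP; rewrite -sqrf_eq0 eq_le sqr_ge0 andbT.
by rewrite -x0 sqr_coord_le_sqnorm.
Qed.

Lemma sqnorm_gt0 n (x : 'cV[R]_n) : (0 < sqnorm x) = (x != 0).
Proof. by rewrite lt_def sqnorm_eq0 sqnorm_ge0 andbT. Qed.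

Lemma sqnormB_le n (x y : 'cV[R]_n) :
  sqnorm (x - y) <= 2 * sqnorm x + 2 * sqnorm y.
Proof.
rewrite /sqnorm !mulr_sumr -big_split /=; apply: ler_sum => i _.
rewrite !mxE; have := sqr_ge0 (x i 0 + y i 0); rewrite !expr2; lra.
Qed.

Lemma quad_formE n (B : 'M[R]_n) x : quad_form B x = \sum_i x i 0 * (B *m x) i 0.
Proof.
by rewrite /quad_form -mulmxA mxE; apply: eq_bigr => i _; rewrite mxE.
Qed.

Lemma quad_form_gram m n (M : 'M[R]_(m, n)) x :
  quad_form (M^T *m M) x = sqnorm (M *m x).
Proof. by rewrite sqnormE /quad_form trmx_mul !mulmxA. Qed.

Lemma quad_formN n (B : 'M[R]_n) x : quad_form (- B) x = - quad_form B x.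
Proof. by rewrite /quad_form mulmxN mulNmx mxE. Qed.

Lemma quad_formB_scalar n (B : 'M[R]_n) t x :
  quad_form (B - t%:M) x = quad_form B x - t * sqnorm x.
Proof.
rewrite /quad_form mulmxBr mulmxBl mxE; congr (_ + _).
by rewrite mul_mx_scalar -scalemxAl !mxE sqnormE mxE.
Qed.

(** The gradient of the form at [x] is [2 B x], so [x - s B x] is a gradient step; symmetry turns
    both cross terms into [|B x|^2]. *)
Lemma quad_formB_mulmx n (B : 'M[R]_n) s (x : 'cV[R]_n) : B^T = B ->
  quad_form B (x - s *: (B *m x)) =
    quad_form B x - 2 * s * sqnorm (B *m x) + s ^+ 2 * quad_form B (B *m x).
Proof.
move=> BT; rewrite sqnormE /quad_form.
have -> : (x - s *: (B *m x))^T = x^T - s *: (x^T *m B).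
  by rewrite linearB linearZ /= trmx_mul BT.
rewrite trmx_mul BT !(mulmxBl, mulmxBr) -?scalemxAl -?scalemxAr -?scalemxAl ?mulmxA.
move: (x^T *m B *m x) (x^T *m B *m B *m x) (x^T *m B *m B *m B *m x) => a b c.
rewrite !mxE; ring.
Qed.

(** Row by row, [|(B x)_i|] is at most the l1 norm of row [i] times [|x|]. The summand 1 keeps the
    constant positive when [B = 0]. *)
Lemma sqnorm_mul_bounded m n (B : 'M[R]_(m, n)) :
  exists2 C, 0 < C & forall x, sqnorm (B *m x) <= C * sqnorm x.
Proof.
exists (1 + \sum_i (\sum_j `|B i j|) ^+ 2).
  by rewrite ltr_pwDl // sumr_ge0 // => i _; apply: sqr_ge0.
move=> x; rewrite mulrDl mul1r ler_wpDl ?sqnorm_ge0 // mulr_suml.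
apply: ler_sum => i _; rewrite mxE.
have H : `|\sum_j B i j * x j 0| <= (\sum_j `|B i j|) * Num.sqrt (sqnorm x).
  apply: le_trans (ler_norm_sum _ _ _) _; rewrite mulr_suml.
  apply: ler_sum => j _; rewrite normrM ler_wpM2l // -sqrtr_sqr.
  by rewrite ler_wsqrtr // sqr_coord_le_sqnorm.
rewrite -[leLHS]real_normK ?num_real // -[X in _ * X](sqr_sqrtr (sqnorm_ge0 _ _)).
rewrite -exprMn lerXn2r ?nnegrE //.
by rewrite mulr_ge0 ?sqrtr_ge0 // sumr_ge0.
Qed.

(** Each term [x_i (B x)_i] is bounded through [|a b| <= a^2 + b^2]. *)
Lemma quad_form_bounded n (B : 'M[R]_n) :
  exists2 C, 0 < C & forall x, `|quad_form B x| <= C * sqnorm x.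
Proof.
have [C C0 HC] := sqnorm_mul_bounded n n B.
exists (1 + C); first by rewrite addr_gt0.
move=> x; rewrite mulrDl mul1r.
apply: le_trans (lerD (lexx _) (HC x)); rewrite quad_formE.
apply: le_trans (ler_norm_sum _ _ _) _; rewrite -big_split /=.
apply: ler_sum => i _; set a := x i 0; set b := (_ *m _) i 0.
rewrite ler_norml; apply/andP; split; nra.
Qed.

(* Take the largest t with t |x|^2 <= x^T B x.  If G = B - t were invertible
   and D bounded its quadratic form q, then q(x - Gx/D) >= 0 would give
   |Gx|^2 <= D q(x), making q coercive and contradicting the choice of t. *)
Lemma min_eigenvalue n (B : 'M[R]_n) : (0 < n)%N -> B^T = B ->
  exists2 t, eigenvalue B t & forall x, t * sqnorm x <= quad_form B x.
Proof.
move=> n0 BT.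
have [C C0 HC] := quad_form_bounded n B.
pose E := [set t | forall x, t * sqnorm x <= quad_form B x].
pose e : 'cV[R]_n := const_mx 1.
have e0 : 0 < sqnorm e.
  rewrite sqnorm_gt0; apply/eqP => /colP/(_ (Ordinal n0)); rewrite !mxE.
  by move/eqP; rewrite oner_eq0.
have E0 : E !=set0.
  exists (- C) => x; rewrite mulNr lerNl; apply: le_trans (HC x).
  by rewrite -normrN ler_norm.
have Eub : has_ubound E.
  by exists (quad_form B e / sqnorm e) => t /(_ e); rewrite ler_pdivlMr.
pose t := sup E.
(* The supremum itself lies in [E]: for nonzero [x] the Rayleigh quotient at [x] is an upper bound
   of [E]. *)
have Et x : t * sqnorm x <= quad_form B x.
  have [->|x0] := eqVneq x 0.
    by have := HC 0; rewrite (eqP (_ : sqnorm 0 == 0)) ?sqnorm_eq0 // !mulr0 normr_le0 => /eqP ->.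
  rewrite -ler_pdivlMr ?sqnorm_gt0 //; apply: ge_sup => // s Es.
  by rewrite ler_pdivlMr ?sqnorm_gt0.
exists t => //; apply: contraT => neig.
pose G := B - t%:M.
have GT : G^T = G by rewrite linearB /= BT tr_scalar_mx.
have Gu : G \in unitmx.
  move: neig; rewrite /eigenvalue /eigenspace negbK kermx_eq0.
  by rewrite row_free_unit.
have [D D0 HD] := quad_form_bounded n G.
have [D' D'0 HD'] := sqnorm_mul_bounded n n (invmx G).
have Gx x : sqnorm (G *m x) <= D * quad_form G x.
  have := Et (x - D^-1 *: (G *m x)).
  rewrite -subr_ge0 -quad_formB_scalar -/G quad_formB_mulmx //.
  have /ler_normlP[_ QD] := HD (G *m x).
  (* With step length [1/D] the second-order term offsets at most half of the first-order decrease
     [2 |Gx|^2 / D]. *)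
  have DD : D^-1 ^+ 2 * quad_form G (G *m x) <= D^-1 * sqnorm (G *m x).
    apply: le_trans (ler_wpM2l (sqr_ge0 _) QD) _.
    by rewrite expr2 -!mulrA mulKf ?lt0r_neq0.
  move=> H; rewrite -ler_pdivrMl //; lra.
(* Since [|x|^2 <= D' |Gx|^2 <= D' D q(x)], the number [t + r] would still lie in [E], above its
   supremum. *)
pose r := (D' * D)^-1.
have r0 : 0 < r by rewrite invr_gt0 mulr_gt0.
suff : t + r <= t by rewrite gerDl leNgt r0.
apply: ub_le_sup => // x.
rewrite mulrDl -lerBrDl -quad_formB_scalar -/G /r -ler_pdivlMl ?invr_gt0 ?mulr_gt0 //.
rewrite invrK -mulrA; apply: le_trans (ler_wpM2l (ltW D'0) (Gx x)).
by rewrite -{1}[x](mulKmx Gu).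
Qed.

Lemma max_eigenvalue n (B : 'M[R]_n) : (0 < n)%N -> B^T = B ->
  exists2 t, eigenvalue B t & forall x, quad_form B x <= t * sqnorm x.
Proof.
move=> n0 BT; have [|t Bt tB] := min_eigenvalue n (- B) n0.
  by rewrite linearN /= BT.
exists (- t); last by move=> x; have := tB x; rewrite quad_formN mulNr lerNr.
have /eigenvalueP[v vB v0] := Bt; apply/eigenvalueP; exists v => //.
by rewrite scaleNr -vB mulmxN opprK.
Qed.

Lemma gram_eigenvector m n (M : 'M[R]_(m, n)) a : eigenvalue (M^T *m M) a ->
  exists2 x, x != 0 & sqnorm (M *m x) = a * sqnorm x.
Proof.
case/eigenvalueP => v vM v0; exists v^T; first by rewrite trmx_eq0.
by rewrite -quad_form_gram /quad_form trmxK vM -scalemxAl mxE sqnormE trmxK.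
Qed.

Lemma full_col_rank_inj m n (M : 'M[R]_(m, n)) : \rank M = n ->
  forall x : 'cV[R]_n, M *m x = 0 -> x = 0.
Proof.
move=> rM x Mx; apply: trmx_inj; apply: (@row_free_inj _ _ _ _ M^T).
  by rewrite /row_free mxrank_tr rM.
by rewrite -!trmx_mul Mx mulmx0.
Qed.

(** This is [|M y| / |y| <= K |M x| / |x|], squared and cross-multiplied so that zero vectors are
    covered. The extreme eigenvalues [a] and [b] of the Gram matrix bound all Rayleigh quotients,
    and the hypothesis gives [b <= K^2 a]. *)
Lemma condition_number_bound m n (M : 'M[R]_(m, n)) (x y : 'cV[R]_n) (K : R) :
  \rank M = n -> condition_number M <= K ->
  sqnorm (M *m y) * sqnorm x <= K ^+ 2 * sqnorm (M *m x) * sqnorm y.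
Proof.
move=> rM cM.
have [n0|n0] := posnP n.
  subst n; have z0 (z : 'cV[R]_0) : sqnorm z = 0.
    by rewrite /sqnorm big_ord0.
  by rewrite !z0 !mulr0.
have Minj := full_col_rank_inj m n M rM.
pose G := M^T *m M.
have GT : G^T = G by rewrite trmx_mul trmxK.
have [a Ga aG] := min_eigenvalue n G n0 GT.
have [b Gb bG] := max_eigenvalue n G n0 GT.
have a0 : 0 < a.
  have [z z0 Mz] := gram_eigenvector m n M a Ga.
  rewrite -(pmulr_lgt0 _ (_ : 0 < sqnorm z)) ?sqnorm_gt0 // -Mz sqnorm_gt0.
  by apply: contraNneq z0 => /Minj ->.
(* The square roots of [a] and [b] are singular values and enclose all others, so [inf] and [sup]
   are attained there. *)
have inS c : 0 <= c -> eigenvalue G c -> singular_values M (Num.sqrt c).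
  by move=> c0 Gc; split; rewrite ?sqrtr_ge0 // sqr_sqrtr.
have bnd s : singular_values M s -> Num.sqrt a <= s <= Num.sqrt b.
  move=> [s0 /gram_eigenvector[z z0 Mz]].
  have := aG z; have := bG z; rewrite quad_form_gram Mz.
  rewrite !ler_pM2r ?sqnorm_gt0 // => sb as_.
  by rewrite -(ger0_norm s0) -sqrtr_sqr !ler_wsqrtr.
have b0 : 0 <= b.
  have [z z0 Mz] := gram_eigenvector m n M b Gb.
  by rewrite -(pmulr_lge0 _ (_ : 0 < sqnorm z)) ?sqnorm_gt0 // -Mz sqnorm_ge0.
have supE : sup (singular_values M) = Num.sqrt b.
  apply/le_anti/andP; split.
    by apply: ge_sup; [exists (Num.sqrt b); exact: inS | move=> s /bnd/andP[]].
  apply: ub_le_sup; last exact: inS.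
  by exists (Num.sqrt b) => s /bnd/andP[].
have infE : inf (singular_values M) = Num.sqrt a.
  apply/le_anti/andP; split.
    apply: ge_inf; last by apply: inS => //; exact: ltW.
    by exists (Num.sqrt a) => s /bnd/andP[].
  apply: lb_le_inf; last by move=> s /bnd/andP[].
  by exists (Num.sqrt a); apply: inS => //; exact: ltW.
move: cM; rewrite /condition_number supE infE ler_pdivrMr ?sqrtr_gt0 // => cM.
have bKa : b <= K ^+ 2 * a.
  rewrite -(sqr_sqrtr b0) -(sqr_sqrtr (ltW a0)) -exprMn.
  by rewrite ler_sqr ?nnegrE ?sqrtr_ge0 // (le_trans _ cM) ?sqrtr_ge0.
have := aG x; have := bG y; rewrite !quad_form_gram => My Mx.
apply: le_trans (ler_wpM2r (sqnorm_ge0 _ _) My) _.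
apply: le_trans (_ : K ^+ 2 * a * sqnorm y * sqnorm x <= _).
  by rewrite !ler_wpM2r ?sqnorm_ge0.
move: (K ^+ 2) (sqr_ge0 K) => k k0; rewrite -!mulrA; apply: ler_wpM2l => //.
by rewrite mulrCA [leRHS]mulrC; apply: ler_wpM2l => //; apply: sqnorm_ge0.
Qed.
End QuadraticForms.

(** * Taylor bounds in one and two variables *)

Section Taylor.
Context {R : realType}.

(** [G k] stands for the k-th derivative of [G 0], so differentiating the polynomial merely shifts
    [G]. There are [n] terms, hence degree below [n]. *)
Definition taylor_poly (G : nat -> R -> R) (n : nat) (x : R) : R :=
  \sum_(k < n) G k 0 * x ^+ k / k`!%:R.

Lemma taylor_poly0 (G : nat -> R -> R) n : taylor_poly G n.+1 0 = G 0%N 0.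
Proof.
rewrite /taylor_poly big_ord_recl big1 ?addr0 ?expr0 ?mulr1 ?divr1 //.
by move=> i _; rewrite expr0n /= mulr0 mul0r.
Qed.

Lemma is_derive_taylor_poly (G : nat -> R -> R) n (x : R) :
  is_derive x 1 (taylor_poly G n.+1) (taylor_poly (fun k => G k.+1) n x).
Proof.
have -> : taylor_poly G n.+1 =
    \sum_(k < n.+1) (fun y => G k 0 / k`!%:R * y ^+ k).
  by apply/funext => y; rewrite fct_sumE; apply: eq_bigr => k _; ring.
have H (k : 'I_n.+1) : is_derive x 1 (fun y : R => G k 0 / k`!%:R * y ^+ k)
    (G k 0 / k`!%:R * (k%:R * x ^+ k.-1)).
  have -> : (fun y : R => G k 0 / k`!%:R * y ^+ k) =
      (G k 0 / k`!%:R) *: ((@id R) ^+ k).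
    by apply/funext => y; rewrite !fctE; congr (_ * _); elim: (k : nat) => [|i IHi]; rewrite ?expr0 // !exprS IHi.
  apply: is_derive_eq; rewrite [LHS]/GRing.scale /= /GRing.scale /=.
  by rewrite mulr1.
have DT := is_derive_sum H; apply: is_derive_eq.
rewrite big_ord_recl /=.  rewrite mul0r mulr0 add0r /taylor_poly.
apply: eq_bigr => k _; rewrite /= /bump /= add1n factS natrM /=; field.
by rewrite pnatr_eq0 -lt0n fact_gt0 nat1r pnatr_eq0.
Qed.

(** The derivative is bounded only up to [|x|], so [B] may depend on [|x|], as the induction for
    Taylor's formula requires. *)
Lemma mean_value_bound (g dg : R -> R) (r B x : R) : `|x| < r ->
  (forall y : R, `|y| < r -> is_derive y 1 g (dg y)) ->
  (forall y, `|y| <= `|x| -> `|dg y| <= B) -> `|g x - g 0| <= B * `|x|.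
Proof.
move=> xr Dg Bg.
have cont (a b : R) : `|a| < r -> `|b| < r -> {within `[a, b], continuous g}.
  move=> ar br; apply: continuous_in_subspaceT => y; rewrite inE /= in_itv /=.
  move=> /andP[ay yb]; apply/differentiable_continuous/derivable1_diffP.
  have /Dg[] // : `|y| < r.
  by move: ar br; rewrite !ltr_norml => /andP[? ?] /andP[? ?]; lra.
have r0 : 0 < r by apply: le_lt_trans xr.
have r0' : `|0 : R| < r by rewrite normr0.
have [x0|x0] := leP 0 x.
  have [||c cx ->] := @MVT_segment R g dg 0 x x0; last first.
  - rewrite subr0 normrM ler_wpM2r // Bg //.
    by move: cx; rewrite in_itv /= => /andP[c0 cx]; rewrite !ger0_norm.
  - exact: cont.
  - move=> y; rewrite in_itv /= => /andP[y0 yx]; apply: Dg.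
    by rewrite gtr0_norm // (lt_le_trans yx) // (le_trans (ler_norm _) (ltW xr)).
have [||c cx E] := @MVT_segment R g dg x 0 (ltW x0).
- move=> y; rewrite in_itv /= => /andP[y0 yx]; apply: Dg.
  move: xr; rewrite !ltr_norml => /andP[? ?]; lra.
- exact: cont.
rewrite distrC E sub0r normrM normrN ler_wpM2r // Bg //.
move: cx; rewrite in_itv /= => /andP[c0 cx].
by rewrite (ltr0_norm x0) ler0_norm // lerN2.
Qed.

(** Induction on [n]: the derivative of the remainder is the previous remainder for the shifted
    sequence, and the remainder vanishes at 0, so the mean value bound gains one factor [|x|]. *)
Lemma taylor_bound (n : nat) (G : nat -> R -> R) (r B : R) :
  (forall k (y : R), (k < n)%N -> `|y| < r -> is_derive y 1 (G k) (G k.+1 y)) ->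
  (forall y, `|y| < r -> `|G n y| <= B) ->
  forall x, `|x| < r -> `|G 0%N x - taylor_poly G n x| <= B * `|x| ^+ n.
Proof.
elim: n G => [|n IHn] G DG BG x xr.
  by rewrite /taylor_poly big_ord0 subr0 expr0 mulr1 BG.
have DGT (y : R) : `|y| < r -> is_derive y 1 (G 0%N - taylor_poly G n.+1)
    (G 1%N y - taylor_poly (fun k => G k.+1) n y).
  move=> yr; apply: is_deriveB; first exact: DG.
  exact: is_derive_taylor_poly.
have B0 : 0 <= B by apply: le_trans (BG x xr).
have := @mean_value_bound _ _ r (B * `|x| ^+ n) x xr DGT.
rewrite !fctE taylor_poly0 subrr subr0 exprSr mulrA; apply=> y yx.
have yr : `|y| < r by apply: le_lt_trans xr.
apply: le_trans (IHn (fun k => G k.+1) _ _ y yr) _.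
- by move=> k z kn zr; apply: DG.
- by move=> z zr; apply: BG.
- by rewrite ler_wpM2l // lerXn2r ?nnegrE.
Qed.

(** Each derivative consumes one order of smoothness, so all orders are carried through the
    induction together. *)
Lemma C_on_partial (U : set (R * R)) f j k : (forall r, C_on U r f) ->
  forall r, C_on U r (partial j k f).
Proof.
move=> Cf; rewrite /partial; elim: j => [|j IHj]; last first.
  by move=> r; have [_ []] := IHj r.+1.
by elim: k => [//|k IHk] r; have [_ []] := IHk r.+1.
Qed.

Lemma C_on_locally_bounded (U : set (R * R)) f z : U z -> (forall r, C_on U r f) ->
  exists2 B, 0 < B & \forall p \near z, `|f p.1 p.2| <= B.
Proof.
move=> Uz /(_ 0%N)[/(_ z Uz) cf _].
exists (`|f z.1 z.2| + 1); first by rewrite ltr_wpDl.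
have /cvgr_norm_le : f p.1 p.2 @[p --> z] --> f z.1 z.2 by [].
by apply; rewrite ltrDl.
Qed.
End Taylor.

Section TaylorPlane.
Context {R : realType}.

(** Finitely many eventual bounds hold simultaneously. The sum uses [|B i|] because the given
    constants may be negative. *)
Lemma near_uniform_bound (I : finType) (T : Type) (F : set_system T)
    (FF : Filter F) (g : I -> T -> R) (e : T -> R) :
  (forall i, exists B, \forall t \near F, `|g i t| <= B * `|e t|) ->
  exists2 B, 0 < B & \forall t \near F, forall i, `|g i t| <= B * `|e t|.
Proof.
move=> /choice[B HB]; exists (1 + \sum_i `|B i|).
  by rewrite ltr_pwDl // sumr_ge0.
apply: filter_forall => i; apply: filterS (HB i) => t gB.
apply: le_trans gB _; rewrite ler_wpM2r //.
rewrite (bigD1 i) //= addrCA ler_wpDr ?ler_norm //.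
by rewrite addr_ge0 // sumr_ge0.
Qed.

(** The exponent of [v] becomes the outer index, matching an expansion first in [v] and then in
    [u]. *)
Lemma sum_exponents d (F : nat -> nat -> R) :
  \sum_(p : exponents d) F (uexp p) (vexp p) =
  \sum_(k < d.+1) \sum_(j < d.+1 - k) F j k.
Proof.
pose Q := fun p : 'I_d.+1 * 'I_d.+1 => (p.1 + p.2 <= d)%N.
rewrite -(big_sub _ (fun p : 'I_d.+1 * 'I_d.+1 => F p.1 p.2) : _ = \sum_(p : exponents d) _).
rewrite (eq_bigl Q) // -(pair_big_dep xpredT (fun i j : 'I_d.+1 => (i + j <= d)%N)
   (fun i j : 'I_d.+1 => F i j)) /= (exchange_big_dep xpredT) //=.
apply: eq_bigr => k _.
rewrite (big_ord_widen_cond d.+1 xpredT (fun j => F j k)) ?leq_subr //=.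
by apply: eq_bigl => j; rewrite ltn_subRL ltnS addnC.
Qed.

Lemma is_derive_partial_u (U : set (R * R)) f j k x y : U (x, y) ->
  (forall r, C_on U r f) ->
  is_derive x 1 (fun s => partial j k f s y) (partial j.+1 k f x y).
Proof.
move=> Uxy Cf; have [_ [/(_ _ Uxy) /= Df _ _ _]] := C_on_partial U f j k Cf 1%N.
by rewrite /partial_u derive1E; apply: derivableP.
Qed.

(** Restricted to [j = 0]: [partial] applies the u-derivatives last, so only then is the
    v-derivative again a [partial] by definition. *)
Lemma is_derive_partial_v (U : set (R * R)) f k x y : U (x, y) ->
  (forall r, C_on U r f) ->
  is_derive y 1 (fun s => partial 0 k f x s) (partial 0 k.+1 f x y).
Proof.
move=> Uxy Cf; have [_ [_ /(_ _ Uxy) /= Df _ _]] := C_on_partial U f 0 k Cf 1%N.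
rewrite -[X in is_derive _ _ _ X]/(derive1 (fun s => partial 0 k f x s) y) derive1E.
exact: derivableP.
Qed.

(* Expanding first in v at fixed u, then each coefficient in u along v = 0,
   produces the derivatives in exactly the order d_u^j d_v^k, so the symmetry
   of mixed derivatives is not needed. *)
Lemma taylor_plane (f : R -> R -> R) (d : nat) : smooth_near_origin f ->
  exists r C : R, [/\ 0 < r, 0 < C & forall t x y : R, t < r ->
    `|x| <= t -> `|y| <= t ->
    `|f x y - \sum_(p : exponents d) partial (uexp p) (vexp p) f 0 0 *
        (x ^+ uexp p * y ^+ vexp p / ((uexp p)`!%:R * (vexp p)`!%:R))|
      <= C * t ^+ d.+1].
Proof.
move=> [U [oU U0 Cf]].
(* All derivatives of total order [d+1] that enter the remainders: [k = d+1] for the expansion in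
   [v], [k <= d] for those in [u]. *)
pose g (k : 'I_d.+2) (p : R * R) := partial (d.+1 - k) k f p.1 p.2.
have [i|B B0 gB] := near_uniform_bound _ _ (nbhs (0 : R, 0 : R)) _ g (fun=> 1).
  have [B _ HB] := C_on_locally_bounded U (partial (d.+1 - i) i f) _ U0
     (C_on_partial U f _ _ Cf).
  by exists B; apply: filterS HB => p; rewrite normr1 mulr1.
have /nbhs_ballP[r /= r0 rP] : nbhs (0 : R, 0 : R)
    (U `&` [set p | forall k, `|g k p| <= B * `|1|]).
  by apply: filterI => //; exact: open_nbhs_nbhs.
(* Balls of the product are squares, so bounding each coordinate separately suffices. *)
have box x y : `|x| < r -> `|y| < r ->
    U (x, y) /\ forall k : 'I_d.+2, `|partial (d.+1 - k) k f x y| <= B.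
  move=> xr yr; have [|Uxy gxy] := rP (x, y).
    by split; rewrite /ball /= sub0r normrN.
  by split => // k; have := gxy k; rewrite normr1 mulr1.
(* There are [d+2] remainders: one in [v] and one in [u] for each of the [d+1] coefficients. *)
exists r, (B *+ d.+2); split=> //; first by rewrite pmulrn_lgt0.
move=> t x y tr xt yt.
have xr := le_lt_trans xt tr; have yr := le_lt_trans yt tr.
have r00 : `|0 : R| < r by rewrite normr0.
have t0 : 0 <= t by apply: le_trans xt.
have Bv s : `|s| < r -> `|partial 0 d.+1 f x s| <= B.
  by move=> sr; have [_ /(_ ord_max)] := box _ _ xr sr; rewrite subnn.
have Bu (k : 'I_d.+1) s : `|s| < r -> `|partial (d.+1 - k) k f s 0| <= B.
  by move=> sr; have [_ /(_ (widen_ord (leqnSn _) k))] := box _ _ sr r00.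
have Tv := taylor_bound d.+1 (fun k s => partial 0 k f x s) r B
  (fun k s _ sr => is_derive_partial_v U f k x s (box _ _ xr sr).1 Cf) Bv y yr.
have Tu (k : 'I_d.+1) := taylor_bound (d.+1 - k) (fun j s => partial j k f s 0) r B
  (fun j s _ sr => is_derive_partial_u U f j k s 0 (box _ _ sr r00).1 Cf) (Bu k) x xr.
rewrite (sum_exponents d (fun j k => partial j k f 0 0 * (x ^+ j * y ^+ k / (j`!%:R * k`!%:R)))).
set S := \sum_(k < _) _.
have -> : f x y - S = (f x y - taylor_poly (fun k s => partial 0 k f x s) d.+1 y) +
   \sum_(k < d.+1) (partial 0 k f x 0 - taylor_poly (fun j s => partial j k f s 0) (d.+1 - k) x)
     * (y ^+ k / k`!%:R).
  rewrite [X in _ = _ + X](eq_bigr (fun k : 'I_d.+1 => partial 0 k f x 0 * y ^+ k / k`!%:R -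
     \sum_(j < d.+1 - k) partial j k f 0 0 * (x ^+ j * y ^+ k / (j`!%:R * k`!%:R)))); last first.
    move=> k _; rewrite mulrBl mulrA; congr (_ - _).
    by rewrite /taylor_poly mulr_suml; apply: eq_bigr => j _; rewrite invfM; ring.
  by rewrite sumrB /taylor_poly addrA subrK.
rewrite mulrnAl mulrS; apply: le_trans (ler_normD _ _) _; apply: lerD.
  apply: le_trans Tv _.
  by rewrite ler_wpM2l ?(ltW B0) // lerXn2r ?nnegrE.
apply: le_trans (ler_norm_sum _ _ _) _.
rewrite -[X in _ *+ X]card_ord -sumr_const; apply: ler_sum => k _.
rewrite normrM.
(* The remainder in [u] supplies [d+1-k] powers of [t], and [y^k] supplies the other [k]. *)
have -> : t ^+ d.+1 = t ^+ (d.+1 - k) * t ^+ k.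
  by rewrite -exprD subnK // ltnW.
rewrite mulrA; apply: ler_pM => //.
  apply: le_trans (Tu k) _.
  by rewrite ler_wpM2l ?(ltW B0) // lerXn2r ?nnegrE.
rewrite normrM normfV normrX normr_nat ler_pdivrMr ?ltr0n ?fact_gt0 //.
apply: le_trans (_ : t ^+ k <= _); first by rewrite lerXn2r ?nnegrE.
by rewrite ler_peMr ?exprn_ge0 // ler1n fact_gt0.
Qed.
End TaylorPlane.

(** * Error of the scaled least squares problem *)

Section LeastSquaresError.
Context {R : realType}.

Lemma mulmx_col_scaling m n (A : 'M[R]_(m, n)) j :
  col j (A *m col_scaling A) = (l2norm (col j A))^-1 *: col j A.
Proof.
by apply/colP => i; rewrite /col_scaling mul_mx_diag !mxE mulrC.
Qed.

(** A zero column stays zero after scaling and would put a basis vector in the kernel. This makes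
    the scaling invertible. *)
Lemma scaled_col_neq0 m n (A : 'M[R]_(m, n)) :
  \rank (A *m col_scaling A) = n -> forall j, col j A != 0.
Proof.
move=> rM j; apply/eqP => Aj.
have /full_col_rank_inj/(_ (delta_mx j 0)) := rM.
rewrite -colE mulmx_col_scaling Aj scaler0 => /(_ erefl)/colP/(_ j)/eqP.
by rewrite !mxE !eqxx oner_eq0.
Qed.

Lemma sqnorm_delta n (j : 'I_n) : sqnorm (delta_mx j 0 : 'cV[R]_n) = 1.
Proof.
rewrite /sqnorm (bigD1 j) //= big1 ?addr0 ?mxE ?eqxx ?expr1n // => i ij.
by rewrite mxE (negbTE ij) expr0n.
Qed.

(** The condition number alone fixes no scale for the singular values. Comparing [x - y] with the
    j-th basis vector, whose image is a unit column, supplies it. *)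
Lemma scaled_least_squares_error m n (A : 'M[R]_(m, n)) (b : 'cV[R]_m)
    (x z : 'cV[R]_n) (K : R) (j : 'I_n) :
  \rank (A *m col_scaling A) = n -> condition_number (A *m col_scaling A) <= K ->
  is_least_squares (A *m col_scaling A) b x ->
  sqnorm (col j A) * ((col_scaling A *m x) j 0 - z j 0) ^+ 2 <=
    4 * K ^+ 2 * sqnorm (A *m z - b).
Proof.
move=> rM cM lsx; set S := col_scaling A in rM cM lsx *.
have l0 k : l2norm (col k A) != 0.
  by rewrite -sqrf_eq0 sqnorm_l2norm sqnorm_eq0 (scaled_col_neq0 m n A rM).
have SE (t : 'cV[R]_n) k : (S *m t) k 0 = (l2norm (col k A))^-1 * t k 0.
  by rewrite /S /col_scaling mul_diag_mx !mxE.
pose y : 'cV[R]_n := \col_k (l2norm (col k A) * z k 0).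
have Sy : S *m y = z by apply/colP => k; rewrite SE mxE mulKf.
(* Minimality of [x] bounds both residuals by that of [z]; [sqnormB_le] then gives [4 = 2 + 2]. *)
have Mxy : sqnorm (A *m S *m (x - y)) <= 4 * sqnorm (A *m z - b).
  have -> : A *m S *m (x - y) = (A *m S *m x - b) - (A *m S *m y - b).
    by rewrite mulmxBr opprB addrA subrK.
  apply: le_trans (sqnormB_le _ _ _) _; rewrite -[_ *m S *m y]mulmxA Sy.
  have : sqnorm (A *m S *m x - b) <= sqnorm (A *m z - b).
    have := lsx y; rewrite -[_ *m S *m y]mulmxA Sy -!sqnorm_l2norm => lxy.
    by rewrite lerXn2r ?nnegrE ?sqrtr_ge0.
  lra.
have := condition_number_bound m n (A *m S) (x - y) (delta_mx j 0) K rM cM.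
rewrite sqnorm_delta mulr1 -colE mulmx_col_scaling.
have -> : sqnorm ((l2norm (col j A))^-1 *: col j A) = 1.
  rewrite /sqnorm (eq_bigr (fun i => (l2norm (col j A))^-1 ^+ 2 * (col j A) i 0 ^+ 2)).
    by rewrite -mulr_sumr -/(sqnorm _) -sqnorm_l2norm -exprMn mulVf // expr1n.
  by move=> i _; rewrite mxE exprMn.
rewrite mul1r => xyK.
have -> : sqnorm (col j A) * ((S *m x) j 0 - z j 0) ^+ 2 = ((x - y) j 0) ^+ 2.
  rewrite -sqnorm_l2norm -exprMn SE !mxE mulrBr mulVKf //.
apply: le_trans (sqr_coord_le_sqnorm _ _ _) _; apply: le_trans xyK _.
by move: (K ^+ 2) (sqr_ge0 K) => k k0; rewrite [4 * _]mulrC -mulrA; apply: ler_wpM2l.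
Qed.

Lemma wls_mxE d m (u v w : 'I_m -> R) i r :
  wls_mx d u v w i r =
    w i * (u i ^+ uexp (enum_val r) * v i ^+ vexp (enum_val r) /
      ((uexp (enum_val r))`!%:R * (vexp (enum_val r))`!%:R)).
Proof. by rewrite /wls_mx /weight_mx mul_diag_mx !mxE. Qed.

(** Reindexing from ordinals to exponents exposes the polynomial appearing in [taylor_plane]. *)
Lemma wls_residualE d m (u v w F : 'I_m -> R) (a : exponents d -> R) i :
  (wls_mx d u v w *m \col_r a (enum_val r) - wls_rhs w F) i 0 =
    w i * (\sum_p a p * (u i ^+ uexp p * v i ^+ vexp p /
      ((uexp p)`!%:R * (vexp p)`!%:R)) - F i).
Proof.
rewrite /wls_rhs /weight_mx mul_diag_mx !mxE mulrBr; congr (_ - _).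
rewrite [in RHS](reindex (@enum_val _ (exponents d))) /=; last first.
  exact/onW_bij/enum_val_bij.
rewrite mulr_sumr; apply: eq_bigr => r _; rewrite wls_mxE mxE; ring.
Qed.

(** If every point were the origin, the column of exponents [(1, 0)], present because [d > 0], would
    vanish. *)
Lemma wls_point_off_origin d m (u v w : 'I_m -> R) : (0 < d)%N ->
  \rank (wls_mx d u v w *m col_scaling (wls_mx d u v w)) = ncoef d ->
  exists i, (u i, v i) <> (0, 0).
Proof.
move=> d0 rM; apply: contrapT => /forallNP all0.
have p0 : (((inord 1, ord0) : 'I_d.+1 * 'I_d.+1).1 + (ord0 : 'I_d.+1) <= d)%N.
  by rewrite /= inordK // addn0.
pose p : exponents d := exist _ (inord 1, ord0) p0.
have /eqP[] := scaled_col_neq0 _ _ _ rM (enum_rank p).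
apply/colP => i; rewrite mxE wls_mxE enum_rankK !mxE.
have /contrapT[-> _] := all0 i.
by rewrite /uexp /= inordK // expr1 !mul0r mulr0.
Qed.

End LeastSquaresError.

(** * Convergence order of the fitted coefficients *)

Theorem theorem4 (R : realType) (d m : nat) (hd : (0 < d)%N)
    (hm : ((d.+1 * d.+2)./2 <= m)%N)
    (f : R -> R -> R) (f_smooth : smooth_near_origin f)
    (u v w F : R -> 'I_m -> R)
    (F_data :
      (\forall h \near (0 : R)^'+, forall i : 'I_m,
         F h i = f (u h i) (v h i)) \/
      (forall i : 'I_m,
         (fun h : R => F h i - f (u h i) (v h i))
           =O_ ((0 : R)^'+) (fun h : R => h ^+ d.+1)))
    (points_indep : points_resolution_independent u v)
    (weights_indep : weights_resolution_independent w)
    (scaled_rank : \forall h \near (0 : R)^'+,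
       let A := wls_mx d (u h) (v h) (w h) in
       \rank (A *m col_scaling A) = ncoef d)
    (scaled_cond : exists K : R, \forall h \near (0 : R)^'+,
       let A := wls_mx d (u h) (v h) (w h) in
       condition_number (A *m col_scaling A) <= K)
    (c : R -> 'cV[R]_(ncoef d))
    (c_fit : \forall h \near (0 : R)^'+,
       is_wls_fitting (u h) (v h) (w h) (F h) (c h)) :
  forall p : exponents d,
    (fun h : R => fitted_coef (c h) p - partial (uexp p) (vexp p) f 0 0)
      =O_ ((0 : R)^'+) (fun h : R => h ^+ (d - uexp p - vexp p + 1)).
Proof.
move=> p.
(* Exact data and data with error [O(h^(d+1))] are merged into one bound, uniform over the
   points. *)
have [B B0 FB] : exists2 B, 0 < B & \forall h \near (0 : R)^'+, forall i : 'I_m,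
    `|F h i - f (u h i) (v h i)| <= B * `|h ^+ d.+1|.
  apply: near_uniform_bound => i; case: F_data => [Ff|/(_ i)/eqO_exP[B _ HB]].
    by exists 0; apply: filterS Ff => h Ff; rewrite Ff subrr normr0 mul0r.
  by exists B.
have [r [C [r0 C0 fC]]] := taylor_plane f d f_smooth.
have [c1 [c2 [c10 c20 uv]]] := points_indep.
have [w1 [w2 [w10 w20 ww]]] := weights_indep.
have [K cK] := scaled_cond.
pose j := uexp p; pose k := vexp p.
have jkd : (j + k <= d)%N by rewrite /j /k /uexp /vexp; case: (p).
(* [a h^(j+k)] will bound the norm of the [(j,k)] column from below, using smallest weight and
   coordinates. *)
pose a : R := w1 * c1 ^+ (j + k) / (j`!%:R * k`!%:R).
have a0 : 0 < a.
  by rewrite divr_gt0 ?mulr_gt0 ?exprn_gt0 ?ltr0n ?fact_gt0.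
(* [D h^(d+1)] bounds each residual entry: largest weight times the sum of Taylor and data
   errors. *)
pose D : R := w2 * (C * c2 ^+ d.+1 + B).
have D0 : 0 < D by rewrite mulr_gt0 // addr_gt0 // mulr_gt0 // exprn_gt0.
(* Adding 1 to the squared error constant [q] avoids a square root: [q <= (1 + q)^2]. *)
pose E : R := 1 + 4 * K ^+ 2 * (m%:R * D ^+ 2).
have KD0 : 0 <= 4 * K ^+ 2 * (m%:R * D ^+ 2).
  by do 2?[apply: mulr_ge0 => //]; exact: sqr_ge0.
have E0 : 0 < E by rewrite ltr_pwDl.
apply/eqO_exP; exists (E / a); first by rewrite divr_gt0.
near=> h.
have h0 : 0 < h by near: h; exact: nbhs_right_gt.
have h0' n : 0 < h ^+ n by exact: exprn_gt0.
have hr : c2 * h < r.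
  rewrite mulrC -ltr_pdivlMr //; near: h; apply: nbhs_right_lt.
  exact: divr_gt0.
have rM : \rank (wls_mx d (u h) (v h) (w h) *m col_scaling (wls_mx d (u h) (v h) (w h)))
    = ncoef d by near: h.
have cM : condition_number (wls_mx d (u h) (v h) (w h) *m
    col_scaling (wls_mx d (u h) (v h) (w h))) <= K by near: h.
have FBh : forall i : 'I_m, `|F h i - f (u h i) (v h i)| <= B * `|h ^+ d.+1|.
  by near: h.
have uvh : forall i : 'I_m, (u h i, v h i) <> (0, 0) ->
    c1 * h <= `|u h i| <= c2 * h /\ c1 * h <= `|v h i| <= c2 * h by near: h.
have wh : forall i : 'I_m, 0 <= w h i /\ w1 <= `|w h i| <= w2 by near: h.
have [x lsx cE] : is_wls_fitting (u h) (v h) (w h) (F h) (c h) by near: h.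
set A := wls_mx d (u h) (v h) (w h) in rM cM lsx cE.
pose g (q : exponents d) := partial (uexp q) (vexp q) f 0 0.
pose z : 'cV[R]_(ncoef d) := \col_l g (enum_val l).
have res : sqnorm (A *m z - wls_rhs (w h) (F h)) <= m%:R * (D * h ^+ d.+1) ^+ 2.
  rewrite -[X in X%:R * _]card_ord mulr_natl -sumr_const; apply: ler_sum => i _.
  rewrite wls_residualE -[leLHS]real_normK ?num_real //.
  rewrite lerXn2r ?nnegrE //; first exact/ltW/mulr_gt0.
  have [_ /andP[_ wi]] := wh i; rewrite normrM -mulrA; apply: ler_pM => //.
  (* The upper bounds hold trivially at the origin, so every point is covered. *)
  have uvi : `|u h i| <= c2 * h /\ `|v h i| <= c2 * h.
    have [uv0|/uvh[/andP[_ ?] /andP[_ ?]] //] := pselect ((u h i, v h i) = (0, 0)).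
    by case: uv0 => -> ->; rewrite normr0 mulr_ge0 // ltW.
  have := fC _ _ _ hr uvi.1 uvi.2; have := FBh i.
  rewrite (ger0_norm (exprn_ge0 _ (ltW h0))) exprMn mulrDl !mulrA.
  set s := \sum_q _ => Fi fi.
  have -> : s - F h i = - (f (u h i) (v h i) - s) - (F h i - f (u h i) (v h i)).
    by ring.
  by apply: le_trans (ler_normB _ _) _; rewrite normrN lerD.
(* The index [i] may vary with [h], but the constants do not. One entry already bounds the column
   norm from below. *)
have [i /uvh[/andP[ui _] /andP[vi _]]] := wls_point_off_origin _ _ _ _ _ hd rM.
have ah0 : 0 <= a * h ^+ (j + k) by exact/ltW/mulr_gt0.
have col_ge : (a * h ^+ (j + k)) ^+ 2 <= sqnorm (col (enum_rank p) A).
  apply: le_trans (sqr_coord_le_sqnorm _ _ i); rewrite mxE wls_mxE enum_rankK.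
  rewrite -[leRHS]real_normK ?num_real // lerXn2r ?nnegrE //.
  have [_ /andP[wi _]] := wh i; rewrite normrM normrM normrM normfV !normrX.
  rewrite (ger0_norm (_ : 0 <= j`!%:R * k`!%:R)) ?mulr_ge0 // /a -/j -/k.
  have -> : w1 * c1 ^+ (j + k) / (j`!%:R * k`!%:R) * h ^+ (j + k) =
      w1 * ((c1 * h) ^+ j * (c1 * h) ^+ k / (j`!%:R * k`!%:R)).
    by rewrite -exprD exprMn; ring.
  have c1h : 0 <= c1 * h by apply: mulr_ge0; exact: ltW.
  have N0 : 0 <= (j`!%:R * k`!%:R)^-1 :> R by rewrite invr_ge0 mulr_ge0.
  apply: ler_pM => //; first exact: ltW.
    by rewrite !mulr_ge0 ?exprn_ge0.
  by apply: ler_wpM2r => //; apply: ler_pM; rewrite ?exprn_ge0 // lerXn2r ?nnegrE.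
have := scaled_least_squares_error _ _ A _ x z K (enum_rank p) rM cM lsx.
rewrite -cE -/(fitted_coef (c h) p) mxE enum_rankK /g.
set e := fitted_coef _ _ - _ => He.
have : (a * h ^+ (j + k) * `|e|) ^+ 2 <= (E * h ^+ d.+1) ^+ 2.
  rewrite exprMn real_normK ?num_real //.
  apply: le_trans (ler_wpM2r (sqr_ge0 e) col_ge) _; apply: le_trans He _.
  apply: le_trans (ler_wpM2l (_ : 0 <= 4 * K ^+ 2) res) _.
    by apply: mulr_ge0 => //; exact: sqr_ge0.
  rewrite /E; set q := 4 * _ * (_ * D ^+ 2) in KD0 *.
  have -> : 4 * K ^+ 2 * (m%:R * (D * h ^+ d.+1) ^+ 2) = q * (h ^+ d.+1) ^+ 2.
    by rewrite /q; ring.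
  rewrite exprMn; apply: (ler_wpM2r (sqr_ge0 _)).
  by move: q KD0 => q q0; rewrite expr2; nra.
rewrite ler_sqr ?nnegrE ?(mulr_ge0 ah0) //; last exact/ltW/mulr_gt0.
(* As [j + k <= d], the truncated subtraction is exact, and the factor [h^(j+k)] cancels against the
   column norm. *)
have -> : h ^+ d.+1 = h ^+ (j + k) * h ^+ (d - j - k + 1).
  by rewrite -exprD -subnDA addnA subnKC // addn1.
rewrite mulrAC [E * _]mulrCA [X in _ <= X]mulrC ler_pM2r // => aeE.
rewrite (gtr0_norm (h0' _)) mulrAC ler_pdivlMr // mulrC.
exact: aeE.
Unshelve. all: by end_near. Qed.
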